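(* Let $a,b\in R^{WD}$, and let $a^{WD}$, $b^{WD}$ be WD inverses of $a$ and $b$ respectively. If $ab=ba$ and $bb^{WD}a^{WD}=a^{WD}bb^{WD}$, then $ab$ is WD invertible and $b^{WD}a^{WD}$ is a WD inverse of $ab$, i.e. $(ab)^{WD}=b^{WD}a^{WD}$.
   Context: $R$ is a proper unital ring with involution: an associative ring with $1$ and a map $*:R\to R$ with $(a+b)^*=a^*+b^*$, $(ab)^*=b^*a^*$, $(a^* )^*=a$, such that $a^*a=0$ implies $a=0$. Weak Drazin (WD) inverse: $a\in R$ is WD invertible if there are $x\in R$ and a positive integer $k$ with $axa=a$, $a^{k+1}x=a^k$, $xa^{k+1}=a^k$. The least positive integer $k$ for which such an $x$ exists is the weak Drazin index $\mathrm{ind}(a)$; any $x$ satisfying the three equations with $k=\mathrm{ind}(a)$ is a WD inverse of $a$ (not unique in general), denoted $a^{WD}$. $R^{WD}$ is the set of WD invertible elements. *)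

(* Defs.v *)
From mathcomp Require Import all_boot all_order all_algebra.

Set Implicit Arguments.
Unset Strict Implicit.
Unset Printing Implicit Defensive.

Import GRing.Theory.
Local Open Scope ring_scope.

(* The zero ring is not excluded, hence pzRingType rather than nzRingType. *)
Record proper_involution (R : pzRingType) (star : R -> R) : Prop := {
  starD : forall a b : R, star (a + b) = star a + star b;
  starM : forall a b : R, star (a * b) = star b * star a;
  starK : involutive star;
  star_proper : forall a : R, star a * a = 0 -> a = 0
}.

Definition wd_eqs (R : pzRingType) (a : R) (k : nat) (x : R) : Prop :=
  [/\ a * x * a = a, a ^+ k.+1 * x = a ^+ k & x * a ^+ k.+1 = a ^+ k].

Definition wd_invertible (R : pzRingType) (a : R) : Prop :=
  exists (x : R) (k : nat), (0 < k)%N /\ wd_eqs a k x.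

(* [wd_index a k] reads ind(a) = k; it is a relation because [a] need not be
   WD invertible. *)
Definition wd_index (R : pzRingType) (a : R) (k : nat) : Prop :=
  [/\ (0 < k)%N,
      exists x : R, wd_eqs a k x
    & forall j : nat, (0 < j)%N -> (exists x : R, wd_eqs a j x) -> (k <= j)%N].

(* The exponent is the index of [a], not just some exponent that works for
   [x]. *)
Definition wd_inverse (R : pzRingType) (a x : R) : Prop :=
  exists2 k : nat, wd_index a k & wd_eqs a k x.

(* Main.v *)
(* With c = a b and w = b^WD a^WD, the three equations for (c, w) hold at the
   exponent m = max(ind a, ind b), which only bounds ind c from above. They
   descend to any exponent k at which some z satisfies the equations: there
   c^k = z^m c^(k+m) = c^(k+m) z^m, so the equations for w at the exponent k + m,
   multiplied by z^m, give those at k. Hence w works at the index of c. *)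
Require Import Defs.
From mathcomp Require Import all_boot all_order all_algebra.

Set Implicit Arguments.
Unset Strict Implicit.
Unset Printing Implicit Defensive.

Import GRing.Theory.
Local Open Scope ring_scope.

Lemma exprS_absorbr (R : pzRingType) (a x : R) (k n : nat) :
  (k <= n)%N -> a ^+ k.+1 * x = a ^+ k -> a ^+ n.+1 * x = a ^+ n.
Proof.
by move=> lekn ax; rewrite -(subnK lekn) -addnS exprD -mulrA ax -exprD.
Qed.

Lemma exprS_absorbl (R : pzRingType) (a x : R) (k n : nat) :
  (k <= n)%N -> x * a ^+ k.+1 = a ^+ k -> x * a ^+ n.+1 = a ^+ n.
Proof.
by move=> lekn xa; rewrite -(subnKC lekn) -addSn exprD mulrA xa -exprD.
Qed.

Lemma wd_eqs_leq (R : pzRingType) (a x : R) (k n : nat) :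
  (k <= n)%N -> wd_eqs a k x -> wd_eqs a n x.
Proof.
move=> lekn [axa ax xa]; split=> //.
  exact: exprS_absorbr lekn ax.
exact: exprS_absorbl lekn xa.
Qed.

(** The innermost [x] cancels one [a] at a time, and the exponent never falls below [k], so the
    absorption rule keeps applying. *)
Lemma exprD_absorbr (R : pzRingType) (a x : R) (k n : nat) :
  a ^+ k.+1 * x = a ^+ k -> a ^+ (k + n) * x ^+ n = a ^+ k.
Proof.
move=> ax; elim: n => [|n IHn]; first by rewrite addn0 expr0 mulr1.
by rewrite exprS mulrA addnS (exprS_absorbr (leq_addr n k) ax).
Qed.

Lemma exprD_absorbl (R : pzRingType) (a x : R) (k n : nat) :
  x * a ^+ k.+1 = a ^+ k -> x ^+ n * a ^+ (k + n) = a ^+ k.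
Proof.
move=> xa; elim: n => [|n IHn]; first by rewrite addn0 expr0 mul1r.
by rewrite exprSr -mulrA addnS (exprS_absorbl (leq_addr n k) xa).
Qed.

Lemma wd_eqs_descent (R : pzRingType) (c w z : R) (k m : nat) :
  wd_eqs c m w -> wd_eqs c k z -> wd_eqs c k w.
Proof.
move=> Hw [_ cz zc].
have [cwc cw wc] := wd_eqs_leq (leq_addl k m) Hw.
split=> //.
  by rewrite exprSr -(exprD_absorbl m zc) -[in RHS]cw exprSr !mulrA.
by rewrite exprS -(exprD_absorbr m cz) -[in RHS]wc exprS !mulrA.
Qed.

(** The least exponent that works for [w] is already the index of [c]: by descent, an exponent that
    works for some other [z] also works for [w]. *)
Lemma wd_eqs_inverse (R : pzRingType) (c w : R) (m : nat) :
  (0 < m)%N -> wd_eqs c m w -> wd_inverse c w.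
Proof.
move=> m_gt0 Hw.
(* A boolean form of the equations for the fixed [w], so that [ex_minnP] can pick the least
   exponent. *)
pose P k := [&& (0 < k)%N, c * w * c == c, c ^+ k.+1 * w == c ^+ k
              & w * c ^+ k.+1 == c ^+ k].
have PP k : reflect ((0 < k)%N /\ wd_eqs c k w) (P k).
  apply: (iffP and4P) => [[k_gt0 /eqP ? /eqP ? /eqP ?] // | [k_gt0 [? ? ?]]].
  by split=> //; apply/eqP.
have exP : exists k, P k by exists m; apply/PP.
case: (ex_minnP exP) => k /PP[k_gt0 Hk] k_min.
exists k => //; split=> //; first by exists w.
by move=> j j_gt0 [z Hz]; apply: k_min; apply/PP; split=> //;
   exact: wd_eqs_descent Hw Hz.
Qed.

Lemma wd_eqsM (R : pzRingType) (a b x y : R) (m : nat) :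
  wd_eqs a m x -> wd_eqs b m y -> a * b = b * a ->
  b * y * x = x * b * y -> wd_eqs (a * b) m (y * x).
Proof.
move=> [axa ax xa] [byb by_ yb] ab byx.
have abX i j : a ^+ i * b ^+ j = b ^+ j * a ^+ i.
  by apply: commrX; apply: commr_sym; apply: commrX; apply: commr_sym.
split.
(* The chain is [ab(yx)ab = ax(byb)a = axba = (axa)b = ab]. *)
- rewrite -(mulrA a) (mulrA b) byx ab !mulrA -[_ * y * b]mulrA.
  by rewrite -[_ * b * (y * b)]mulrA (mulrA b) byb -mulrA -ab mulrA axa.
(* The power of [b] absorbs [y] first; then [abX] brings the power of [a] next to [x]. The last
   equation mirrors this, with [x] absorbed first. *)
- rewrite !exprMn_comm // -mulrA [b ^+ _ * _]mulrA by_ mulrA abX -mulrA ax.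
  by rewrite abX.
- by rewrite !exprMn_comm // -mulrA [x * _]mulrA xa abX mulrA yb abX.
Qed.

Theorem theorem3p2 (R : pzRingType) (star : R -> R)
    (Hstar : proper_involution star)
    (a b : R) (Ha : wd_invertible a) (Hb : wd_invertible b)
    (aWD bWD : R) (HaWD : wd_inverse a aWD) (HbWD : wd_inverse b bWD)
    (Hab : a * b = b * a)
    (Hcomm : b * bWD * aWD = aWD * b * bWD) :
  wd_invertible (a * b) /\ wd_inverse (a * b) (bWD * aWD).
Proof.
case: HaWD HbWD => [k [k_gt0 _ _] Hx] [l _ Hy].
have m_gt0 : (0 < maxn k l)%N by rewrite leq_max k_gt0.
have Hw := wd_eqsM (wd_eqs_leq (leq_maxl k l) Hx)
                   (wd_eqs_leq (leq_maxr k l) Hy) Hab Hcomm.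
by split; [exists (bWD * aWD), (maxn k l) | exact: wd_eqs_inverse Hw].
Qed.
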